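(* Let $(X,d)$ be a metric space containing at least 2 points and on which at least one doubling measure exists. Then $$\sup\big\{C_\mu:\mu \text{ doubling measure on }(X,d)\big\}=\infty.$$
   Context: For a metric space $(X,d)$, write $B(x,r)=\{y\in X: d(x,y)<r\}$ for $x\in X$, $r>0$. All measures $\mu$ on $X$ considered are Borel regular and non-trivial in the sense that $0<\mu(B(x,r))<\infty$ for every $x\in X$ and $r>0$. Such a $\mu$ is called doubling if there is a constant $C\ge 1$ with $\mu(B(x,2r))\le C\mu(B(x,r))$ for all $x\in X$, $r>0$; in that case $C_\mu=\sup_{x\in X,\,r>0}\frac{\mu(B(x,2r))}{\mu(B(x,r))}$. *)

(* Defs.v *)
From mathcomp Require Import all_boot all_order all_algebra.
From mathcomp Require Import all_classical all_reals all_analysis.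

Set Implicit Arguments.
Unset Strict Implicit.
Unset Printing Implicit Defensive.

Import Order.TTheory GRing.Theory Num.Theory.

Local Open Scope classical_set_scope.
Local Open Scope ring_scope.
Local Open Scope ereal_scope.

Section doubling.
Context {R : realType} {X : metricType R}.
Implicit Type mu : {outer_measure set X -> \bar R}.

(* As usual where Borel regularity is concerned (Federer 2.2.3), a "measure on
   X" is an outer measure, defined on all subsets of X. *)
Definition borel_regular mu : Prop :=
  (forall U : set X, open U -> mu.-caratheodory U) /\
  (forall A : set X, exists B : set X,
     [/\ <<s @open X >> B, A `<=` B & mu B = mu A]).

(* By ballEmdist, ball x r = [set y | mdist x y < r] in a metricType. *)
Definition nontrivial mu : Prop :=
  forall (x : X) (r : R), (0 < r)%R -> 0 < mu (ball x r) < +oo.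

Definition admissible mu : Prop := borel_regular mu /\ nontrivial mu.

Definition doubling mu : Prop :=
  exists2 C : R, (1 <= C)%R &
    forall (x : X) (r : R), (0 < r)%R ->
      mu (ball x (2 * r)%R) <= C%:E * mu (ball x r).

Definition doubling_measure mu : Prop := admissible mu /\ doubling mu.

Definition doubling_constant mu : \bar R :=
  ereal_sup [set c | exists (x : X) (r : R),
    (0 < r)%R /\ c = mu (ball x (2 * r)%R) / mu (ball x r)].

End doubling.

(* Main.v *)
(* Take a ball [B = B(x, r)] such that [B(x, 2r) \ B] has positive measure; one
   exists around any point [x] that is not alone in [X], since with
   [d = d(x, y) > 0] the ball [B(y, d/2)] lies in [B(x, 2d) \ B(x, d/2)], so that
   [r = d] or [r = d/2] will do. Multiplying the measure by [1 + M] outside [B]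
   changes the measure of any set by a factor in [[1, 1 + M]], so it preserves
   doubling, but it makes the ratio of [B(x, 2r)] to [B] grow linearly in [M]. *)
Require Import Defs.
From HB Require Import structures.
From mathcomp Require Import all_boot all_order all_algebra.
From mathcomp Require Import all_classical all_reals all_analysis.
From mathcomp Require Import lra.

Import Order.TTheory GRing.Theory Num.Theory.

Local Open Scope classical_set_scope.

Lemma metric_ball_open (R : realType) (X : metricType R) (x : X) (r : R) :
  open (ball x r).
Proof.
rewrite openE => y; rewrite ballEmdist/= => xy.
apply/nbhs_ballP; exists (r - mdist x y)%R => /=; first by rewrite subr_gt0.
move=> z; rewrite !ballEmdist/= => yz.
by rewrite (le_lt_trans (metric_triangle x y z))// -ltrBrDl.
Qed.

Section generated_sigma_algebra.
Context {T : Type} (G : set (set T)).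

Lemma generated_sigma_algebraC A : <<s G >> A -> <<s G >> (~` A).
Proof. by move=> sA; rewrite -setTD; exact: sigma_algebraCD. Qed.

Lemma generated_sigma_algebraU A B :
  <<s G >> A -> <<s G >> B -> <<s G >> (A `|` B).
Proof.
move=> sA sB; rewrite -bigcup2E; apply: sigma_algebra_bigcup => -[|[|n]] //=.
exact: sigma_algebra0.
Qed.

Lemma generated_sigma_algebraI A B :
  <<s G >> A -> <<s G >> B -> <<s G >> (A `&` B).
Proof.
move=> sA sB; rewrite -[_ `&` _]setCK setCI.
apply: generated_sigma_algebraC; apply: generated_sigma_algebraU;
  exact: generated_sigma_algebraC.
Qed.

End generated_sigma_algebra.

Section add_outside.
Local Open Scope ereal_scope.
Context {R : realType} {T : Type}.
Variables (mu : {outer_measure set T -> \bar R}%R) (B : set T).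
Variable M : {nonneg R}%R.

(** For [mu]-measurable [B], this is [mu] with density [1] on [B] and [1 + M] off [B]. Written as a
    sum rather than an integral, it makes sense on every set and is again an outer measure. *)
Definition add_outside (A : set T) : \bar R :=
  mu A + M%:num%:E * mu (A `\` B).

Let M_ge0 : 0 <= M%:num%:E. Proof. by rewrite lee_fin. Qed.

Let mu_ge0 A : 0 <= mu A. Proof. exact: outer_measure_ge0. Qed.

Let add_outside0 : add_outside set0 = 0.
Proof. by rewrite /add_outside set0D outer_measure0 mule0 adde0. Qed.

Let add_outside_ge0 A : 0 <= add_outside A.
Proof. by rewrite adde_ge0 ?mule_ge0. Qed.

Let le_add_outside : {homo add_outside : A C / A `<=` C >-> A <= C}.
Proof.
move=> A C AC; rewrite leeD ?lee_wpmul2l ?le_outer_measure//.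
exact: setSD.
Qed.

Let add_outside_sigma_subadditive : sigma_subadditive add_outside.
Proof.
move=> F; rewrite nneseriesD//; last by move=> *; rewrite mule_ge0.
rewrite nneseriesZl// leeD ?outer_measure_sigma_subadditive//.
rewrite lee_wpmul2l// setDE setI_bigcupl.
exact: outer_measure_sigma_subadditive.
Qed.

HB.instance Definition _ := isOuterMeasure.Build R T add_outside
  add_outside0 add_outside_ge0 le_add_outside add_outside_sigma_subadditive.

Lemma add_outside_ge A : mu A <= add_outside A.
Proof. by rewrite /add_outside leeDl ?mule_ge0. Qed.

Lemma add_outside_le A : add_outside A <= (1 + M%:num)%:E * mu A.
Proof.
rewrite EFinD ge0_muleDl// mul1e leeD2l// lee_wpmul2l// le_outer_measure//.
Qed.

Lemma add_outside_self : add_outside B = mu B.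
Proof. by rewrite /add_outside setDv outer_measure0 mule0 adde0. Qed.

(** Cutting by [U] commutes with removing [B], so the criterion for [mu], applied to [A] and to
    [A \ B], splits both terms. *)
Lemma add_outside_caratheodory U :
  mu.-caratheodory U -> add_outside.-caratheodory U.
Proof.
move=> mU A; rewrite /add_outside addeACA -mU -ge0_muleDr//.
by rewrite !setDE !(setIAC _ _ (~` B)) -mU.
Qed.

End add_outside.

Section add_outside_metric.
Local Open Scope ereal_scope.
Context {R : realType} {X : metricType R}.
Implicit Types (mu : {outer_measure set X -> \bar R}%R) (M : {nonneg R}%R).

(** Borel hulls of [A] inside and outside [B] are taken separately and trimmed to their side of [B].
    This controls both terms of [add_outside] without subtracting possibly infinite measures. *)
Lemma borel_regular_add_outside mu B M : open B ->
  borel_regular mu -> borel_regular (add_outside mu B M).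
Proof.
move=> oB [mu_open mu_hull].
have sB : <<s @open X >> B by exact: sub_sigma_algebra.
split=> [U oU|A]; first exact/add_outside_caratheodory/mu_open.
have [C [sC AC muC]] := mu_hull (A `&` B).
have [D [sD AD muD]] := mu_hull (A `\` B).
pose E := (C `&` B) `|` (D `\` B); exists E.
have AE : A `<=` E.
  move=> a Aa; have [Ba|nBa] := pselect (B a); first by left; split=> //; exact: AC.
  by right; split=> //; exact: AD.
split=> //.
  apply: generated_sigma_algebraU; first exact: generated_sigma_algebraI.
  by rewrite setDE; apply: generated_sigma_algebraI => //;
    exact: generated_sigma_algebraC.
apply/eqP; rewrite eq_le; apply/andP; split; last exact: le_outer_measure.
rewrite /= /add_outside leeD//.
  (* As [B] is open, [mu A] is the sum of the measures of its two parts, that is, of the two hulls,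
     which together cover [E]. *)
  rewrite (mu_open _ oB A) -setDE -muC -muD.
  apply: le_trans (outer_measureU2 _ _ _) _.
  by rewrite leeD// le_outer_measure.
rewrite lee_wpmul2l// -muD le_outer_measure//.
by move=> z [[[_ Bz] nBz|[]]].
Qed.

Lemma nontrivial_add_outside mu B M :
  nontrivial mu -> nontrivial (add_outside mu B M).
Proof.
move=> mu_ball x r /(mu_ball x) /andP[mu_gt0 mu_lty]; apply/andP; split.
  exact: lt_le_trans (add_outside_ge _ _ _ _).
apply: le_lt_trans (add_outside_le _ _ _ _) _.
by rewrite lte_mul_pinfty// lee_fin addr_ge0.
Qed.

Lemma doubling_add_outside mu B M :
  doubling mu -> doubling (add_outside mu B M).
Proof.
(* The factor [1 + M] is lost on the large ball; returning from [mu] to the new measure on the small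
   ball costs nothing. *)
move=> [C C_ge1 muC]; exists ((1 + M%:num) * C)%R => [|x r r_gt0].
  by rewrite mulr_ege1// lerDl.
apply: le_trans (add_outside_le _ _ _ _) _.
rewrite EFinM -muleA lee_wpmul2l ?lee_fin ?addr_ge0//.
apply: le_trans (muC _ _ r_gt0) _.
rewrite lee_wpmul2l ?lee_fin ?(le_trans _ C_ge1)//; exact: add_outside_ge.
Qed.

Lemma exists_ball_doubling_gt0 mu : nontrivial mu -> (exists x y : X, x <> y) ->
  exists (x : X) (r : R), (0 < r)%R /\ 0 < mu (ball x (2 * r)%R `\` ball x r).
Proof.
move=> mu_ball [x [y xy]]; set d := mdist x y.
have {xy} d_gt0 : (0 < d)%R by rewrite mdist_gt0; exact/eqP.
have h_gt0 : (0 < d / 2)%R by rewrite divr_gt0.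
(* Points of this ball lie at distance between [d / 2] and [3 * d / 2] from [x]. Since
   [2 * (d / 2) = d], the two annuli meet at radius [d] and cover that range. *)
have sub : ball y (d / 2)%R `<=`
    (ball x (2 * d)%R `\` ball x d) `|`
    (ball x (2 * (d / 2))%R `\` ball x (d / 2)%R).
  rewrite !ballEmdist => z /= yz.
  have := metric_triangle x y z; have := metric_triangle x z y.
  rewrite (metric_sym z) -/d => xzy xyz.
  have [xz|xz] := ltP (mdist x z) d; [right|left]; split=> /=; lra.
have /andP[muy _] := mu_ball y _ h_gt0.
have := lt_le_trans muy (le_outer_measure mu _ _ sub).
move=> /lt_le_trans/(_ (outer_measureU2 _ _ _)) mu_gt0.
(* The two annuli have measures with positive sum, so if the outer one is null, the inner one is
   not. *)
have [d2|] := ltP 0 (mu (ball x (2 * d)%R `\` ball x d)).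
  by exists x, d.
move=> mu_le0; exists x, (d / 2)%R; split=> //.
by apply: lt_le_trans mu_gt0 _; rewrite geeDr.
Qed.

(** The single ratio at [x] and [r] suffices: its denominator is still [mu (ball x r)], and its
    numerator is at least the mass added on the annulus. *)
Lemma doubling_constant_add_outside mu (x : X) (r : R) M : (0 < r)%R ->
  M%:num%:E * mu (ball x (2 * r)%R `\` ball x r) / mu (ball x r)
  <= doubling_constant (add_outside mu (ball x r) M).
Proof.
move=> r_gt0; apply: le_ereal_sup_tmp; eexists.
  by exists x, r; split.
rewrite /= add_outside_self lee_wpmul2r//.
  by rewrite inve_ge0 outer_measure_ge0.
by rewrite /add_outside leeDr// outer_measure_ge0.
Qed.

End add_outside_metric.

Theorem proposition2p4 (R : realType) (X : metricType R)
    (two_points : exists x y : X, x <> y)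
    (doubling_exists : exists mu : {outer_measure set X -> \bar R}%R,
      doubling_measure mu) :
  ereal_sup [set doubling_constant mu |
    mu in [set mu : {outer_measure set X -> \bar R}%R | doubling_measure mu]]
  = +oo%E.
Proof.
have [mu [[mu_reg mu_ball] mu_dbl]] := doubling_exists.
have [x [r [r_gt0 e_gt0]]] := exists_ball_doubling_gt0 mu mu_ball two_points.
have /andP[a_gt0 a_lty] := mu_ball x _ r_gt0.
have e_lty : (mu (ball x (2 * r) `\` ball x r) < +oo)%E.
  have /andP[_] : (0 < mu (ball x (2 * r)) < +oo)%E by exact/mu_ball/mulr_gt0.
  by apply: le_lt_trans; apply: le_outer_measure; exact: subDsetl.
apply/eqyP => K K_gt0; apply: le_ereal_sup_tmp.
set e := mu (_ `\` _) in e_gt0 e_lty; set a := mu (ball x r) in a_gt0 a_lty.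
have e_fin : e \is a fin_num by rewrite ge0_fin_numE// ltW.
have a_fin : a \is a fin_num by rewrite ge0_fin_numE// ltW.
have fe_gt0 : (0 < fine e)%R by rewrite fine_gt0// e_gt0.
have fa_gt0 : (0 < fine a)%R by rewrite fine_gt0// a_gt0.
(* This weight [M] solves [M * e / a = K], so the lower bound for the new doubling constant is
   exactly [K]. *)
have M_ge0 : (0 <= K * fine a / fine e)%R by rewrite ltW// divr_gt0// mulr_gt0.
pose nu : {outer_measure set X -> \bar R}%R :=
  add_outside mu (ball x r) (NngNum M_ge0).
exists (doubling_constant nu).
  exists nu => //; split; last exact: doubling_add_outside.
  split; last exact: nontrivial_add_outside.
  exact/borel_regular_add_outside/mu_reg/metric_ball_open.
apply: le_trans (doubling_constant_add_outside mu x r _ r_gt0).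
rewrite /= -/e -/a -(fineK e_fin) -(fineK a_fin) inver gt_eqF//=.
by rewrite -!EFinM lee_fin divfK ?gt_eqF// mulfK ?gt_eqF.
Qed.
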